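(* Let $\mathbf{k}$ be an algebraically closed field, let $\mathcal{C}$ be a finite tensor category over $\mathbf{k}$ and let $F: \mathcal{C} \to \mathcal{C}$ be a right exact tensor functor. Then the group $\mathrm{Aut}_\otimes(F)$ of monoidal natural automorphisms of $F$ is finite. In particular, $\mathrm{Aut}_\otimes(\mathrm{id}_\mathcal{C})$ is finite.
   Context: A tensor category over $\mathbf{k}$ means a $\mathbf{k}$-linear abelian rigid monoidal category $\mathcal{C}$ such that: the unit object $\mathbf{1} \in \mathcal{C}$ is simple; the tensor product $\otimes: \mathcal{C} \times \mathcal{C} \to \mathcal{C}$ is $\mathbf{k}$-linear in both variables; every object of $\mathcal{C}$ is of finite length; every hom-set in $\mathcal{C}$ is finite-dimensional over $\mathbf{k}$. A $\mathbf{k}$-linear abelian category is finite if it is $\mathbf{k}$-linearly equivalent to the category of finitely generated modules over a finite-dimensional $\mathbf{k}$-algebra; a finite tensor category is a tensor category that is finite in this sense. A tensor functor is a $\mathbf{k}$-linear strong monoidal functor between tensor categories. A monoidal natural automorphism of $F$ is an invertible natural transformation $F \to F$ compatible with the monoidal structure morphisms for both tensor products and unit objects; these form the group $\mathrm{Aut}_\otimes(F)$ under composition. *)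

(* Defs.v *)
From HB Require Import structures.
From mathcomp Require Import all_boot all_order all_algebra all_field.
From mathcomp Require Import all_classical.

Set Implicit Arguments.
Unset Strict Implicit.
Unset Printing Implicit Defensive.

Import GRing.Theory.
Local Open Scope ring_scope.

Declare Scope cat_scope.
Delimit Scope cat_scope with CAT.
Local Open Scope cat_scope.

Record lincat (k : fieldType) := LinCat {
  ob :> Type;
  hom : ob -> ob -> lmodType k;
  idm : forall X, hom X X;
  comp : forall X Y Z, hom Y Z -> hom X Y -> hom X Z;
  comp1m : forall X Y (f : hom X Y), comp (idm Y) f = f;
  compm1 : forall X Y (f : hom X Y), comp f (idm X) = f;
  compA : forall W X Y Z (h : hom Y Z) (g : hom X Y) (f : hom W X),
    comp h (comp g f) = comp (comp h g) f;
  comp_linl : forall X Y Z (a : k) (g g' : hom Y Z) (f : hom X Y),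
    comp (a *: g + g') f = a *: comp g f + comp g' f;
  comp_linr : forall X Y Z (a : k) (g : hom Y Z) (f f' : hom X Y),
    comp g (a *: f + f') = a *: comp g f + comp g f'
}.

Arguments hom {k l} X Y.
Arguments idm {k l} X.
Arguments comp {k l X Y Z} g f.

Notation "g \o f" := (comp g f) : cat_scope.

Record iso (k : fieldType) (C : lincat k) (X Y : C) := Iso {
  isom :> hom X Y;
  isoV : hom Y X;
  isoVm : isoV \o isom = idm X;
  isomV : isom \o isoV = idm Y
}.

Definition id_iso (k : fieldType) (C : lincat k) (X : C) : iso X X :=
  Iso (comp1m (idm X)) (comp1m (idm X)).

Definition is_iso (k : fieldType) (C : lincat k) (X Y : C) (f : hom X Y) :=
  exists g : hom Y X, g \o f = idm X /\ f \o g = idm Y.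

(* Hom-sets are inhabited by 0, so this says that X is initial and terminal. *)
Definition is_zero_ob (k : fieldType) (C : lincat k) (X : C) :=
  forall Y : C, (forall f : hom X Y, f = 0) /\ (forall f : hom Y X, f = 0).

Definition is_mono (k : fieldType) (C : lincat k) (X Y : C) (f : hom X Y) :=
  forall (W : C) (u v : hom W X), f \o u = f \o v -> u = v.

Definition is_epi (k : fieldType) (C : lincat k) (X Y : C) (f : hom X Y) :=
  forall (Z : C) (u v : hom Y Z), u \o f = v \o f -> u = v.

Definition is_kernel (k : fieldType) (C : lincat k) (K X Y : C)
    (i : hom K X) (f : hom X Y) :=
  f \o i = 0 /\
  forall (W : C) (u : hom W X), f \o u = 0 -> exists! v : hom W K, i \o v = u.

Definition is_cokernel (k : fieldType) (C : lincat k) (X Y Q : C)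
    (p : hom Y Q) (f : hom X Y) :=
  p \o f = 0 /\
  forall (W : C) (u : hom Y W), u \o f = 0 -> exists! v : hom Q W, v \o p = u.

Definition is_biproduct (k : fieldType) (C : lincat k) (X Y P : C) :=
  exists (i : hom X P) (j : hom Y P) (p : hom P X) (q : hom P Y),
    [/\ p \o i = idm X, q \o j = idm Y, p \o j = 0, q \o i = 0 &
        (i \o p) + (j \o q) = idm P].

Record abelian_cat (k : fieldType) (C : lincat k) : Prop := AbelianCat {
  has_zero_ob : exists Z : C, is_zero_ob Z;
  has_biproducts : forall X Y : C, exists P : C, is_biproduct X Y P;
  has_kernels : forall (X Y : C) (f : hom X Y),
    exists (K : C) (i : hom K X), is_kernel i f;
  has_cokernels : forall (X Y : C) (f : hom X Y),
    exists (Q : C) (p : hom Y Q), is_cokernel p f;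
  mono_is_kernel : forall (X Y : C) (f : hom X Y), is_mono f ->
    exists (Z : C) (g : hom Y Z), is_kernel f g;
  epi_is_cokernel : forall (X Y : C) (f : hom X Y), is_epi f ->
    exists (Z : C) (g : hom Z X), is_cokernel f g
}.

Definition simple_ob (k : fieldType) (C : lincat k) (X : C) :=
  ~ is_zero_ob X /\
  forall (Y : C) (f : hom Y X), is_mono f -> is_zero_ob Y \/ is_iso f.

(* A derivation is a composition series of X. *)
Inductive finite_length (k : fieldType) (C : lincat k) : C -> Prop :=
| FiniteLength0 (X : C) : is_zero_ob X -> finite_length X
| FiniteLengthS (Y X S : C) (i : hom Y X) (p : hom X S) :
    is_mono i -> is_cokernel p i -> simple_ob S ->
    finite_length Y -> finite_length X.

Definition findim (k : fieldType) (V : lmodType k) :=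
  exists n : nat, inhabited (Vector.axiom n V).

Record linfunctor (k : fieldType) (C D : lincat k) := LinFunctor {
  fob :> C -> D;
  fhom : forall X Y : C, hom X Y -> hom (fob X) (fob Y);
  fhom_linear : forall X Y : C, linear (@fhom X Y);
  fhom1 : forall X : C, fhom (idm X) = idm (fob X);
  fhomM : forall (X Y Z : C) (g : hom Y Z) (f : hom X Y),
    fhom (g \o f) = fhom g \o fhom f
}.

Arguments fhom {k C D} F {X Y} f : rename.

Definition id_functor (k : fieldType) (C : lincat k) : linfunctor C C.
Proof. by refine (@LinFunctor k C C id (fun X Y f => f) _ _ _). Defined.

Definition comp_functor (k : fieldType) (C D E : lincat k)
  (G : linfunctor D E) (F : linfunctor C D) : linfunctor C E.
Proof.
refine (@LinFunctor k C E (fun X => G (F X))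
  (fun X Y f => fhom G (fhom F f)) _ _ _).
- by move=> X Y a f g; rewrite !fhom_linear.
- by move=> X; rewrite !fhom1.
- by move=> X Y Z g f; rewrite !fhomM.
Defined.

Definition is_natural (k : fieldType) (C D : lincat k) (F G : linfunctor C D)
    (t : forall X : C, hom (F X) (G X)) :=
  forall (X Y : C) (f : hom X Y), t Y \o fhom F f = fhom G f \o t X.

Definition nat_isomorphic (k : fieldType) (C D : lincat k)
    (F G : linfunctor C D) :=
  exists t : forall X : C, hom (F X) (G X),
    is_natural t /\ forall X, is_iso (t X).

Definition lin_equivalent (k : fieldType) (C D : lincat k) :=
  exists (F : linfunctor C D) (G : linfunctor D C),
    nat_isomorphic (comp_functor G F) (id_functor C) /\
    nat_isomorphic (comp_functor F G) (id_functor D).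

(* Right exactness of a functor between abelian categories: a sequence
   X -f-> Y -p-> Q -> 0 is exact iff p is a cokernel of f. *)
Definition right_exact (k : fieldType) (C D : lincat k) (F : linfunctor C D) :=
  forall (X Y Q : C) (f : hom X Y) (p : hom Y Q),
    is_cokernel p f -> is_cokernel (fhom F p) (fhom F f).

Definition fin_gen (R : pzRingType) (M : lmodType R) :=
  exists (n : nat) (g : 'I_n -> M),
    forall x : M, exists c : 'I_n -> R, x = \sum_i c i *: g i.

Record fgmod (k : fieldType) (A : falgType k) := FgMod {
  fgmod_sort :> lmodType A;
  fgmodP : fin_gen fgmod_sort
}.

Definition fgmod_hom (k : fieldType) (A : falgType k) (M N : fgmod A) : Type :=
  {linear M -> N}.

Section FgModHom.
Variables (k : fieldType) (A : falgType k).

Section Lmodule.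
Variables M N : fgmod A.
Implicit Types (f g h : fgmod_hom M N) (a b : k).

HB.instance Definition _ := gen_eqMixin (fgmod_hom M N).
HB.instance Definition _ := gen_choiceMixin (fgmod_hom M N).

Lemma fgmod_homP f g : (forall x, f x = g x) -> f = g.
Proof.
case: f g => [f [[cf] [cf']]] [g [[cg] [cg']]] /= e.
have efg : f = g by apply: funext.
subst g.
by rewrite (Prop_irrelevance cf cg) (Prop_irrelevance cf' cg').
Qed.

Definition fgmod_hom_add f g : fgmod_hom M N := f \+ g.
Definition fgmod_hom_opp f : fgmod_hom M N := \- f.
Definition fgmod_hom_zero : fgmod_hom M N := \0.

Lemma fgmod_hom_addA : associative fgmod_hom_add.
Proof. by move=> f g h; apply: fgmod_homP => x /=; rewrite addrA. Qed.
Lemma fgmod_hom_addC : commutative fgmod_hom_add.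
Proof. by move=> f g; apply: fgmod_homP => x /=; rewrite addrC. Qed.
Lemma fgmod_hom_add0 : left_id fgmod_hom_zero fgmod_hom_add.
Proof. by move=> f; apply: fgmod_homP => x /=; rewrite add0r. Qed.
Lemma fgmod_hom_addN : left_inverse fgmod_hom_zero fgmod_hom_opp fgmod_hom_add.
Proof. by move=> f; apply: fgmod_homP => x /=; rewrite addNr. Qed.

HB.instance Definition _ := GRing.isZmodule.Build (fgmod_hom M N)
  fgmod_hom_addA fgmod_hom_addC fgmod_hom_add0 fgmod_hom_addN.

(* k acts through the central subring k%:A of A. *)
Lemma fgmod_hom_scale_linear a f : linear (fun x : M => a%:A *: f x : N).
Proof.
move=> c x y; rewrite linearP scalerDr !scalerA; congr (_ *: _ + _).
by rewrite mulr_algl mulr_algr.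
Qed.

Definition fgmod_hom_scale a f : fgmod_hom M N :=
  HB.pack (fun x : M => a%:A *: f x : N)
    (GRing.isLinear.Build A M N *:%R _ (fgmod_hom_scale_linear a f)).

Lemma fgmod_hom_scaleA a b f :
  fgmod_hom_scale a (fgmod_hom_scale b f) = fgmod_hom_scale (a * b) f.
Proof.
by apply: fgmod_homP => x /=; rewrite scalerA mulr_algl scalerA.
Qed.
Lemma fgmod_hom_scale1 : left_id 1 fgmod_hom_scale.
Proof. by move=> f; apply: fgmod_homP => x /=; rewrite !scale1r. Qed.
Lemma fgmod_hom_scaleDr : right_distributive fgmod_hom_scale +%R.
Proof. by move=> a f g; apply: fgmod_homP => x /=; rewrite scalerDr. Qed.
Lemma fgmod_hom_scaleDl f :
  {morph fgmod_hom_scale^~ f : a b / a + b}.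
Proof. by move=> a b; apply: fgmod_homP => x /=; rewrite !scalerDl. Qed.

HB.instance Definition _ := GRing.Zmodule_isLmodule.Build k (fgmod_hom M N)
  fgmod_hom_scaleA fgmod_hom_scale1 fgmod_hom_scaleDr fgmod_hom_scaleDl.

End Lmodule.

Definition fgmod_id (M : fgmod A) : fgmod_hom M M := idfun.
Definition fgmod_comp (M N P : fgmod A) (g : fgmod_hom N P)
  (f : fgmod_hom M N) : fgmod_hom M P := ssrfun.comp g f.

Lemma fgmod_comp1m M N (f : fgmod_hom M N) : fgmod_comp (fgmod_id N) f = f.
Proof. exact: fgmod_homP. Qed.
Lemma fgmod_compm1 M N (f : fgmod_hom M N) : fgmod_comp f (fgmod_id M) = f.
Proof. exact: fgmod_homP. Qed.
Lemma fgmod_compA M N P Q (h : fgmod_hom P Q) (g : fgmod_hom N P)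
  (f : fgmod_hom M N) :
  fgmod_comp h (fgmod_comp g f) = fgmod_comp (fgmod_comp h g) f.
Proof. exact: fgmod_homP. Qed.
Lemma fgmod_comp_linl M N P (a : k) (g g' : fgmod_hom N P)
  (f : fgmod_hom M N) :
  fgmod_comp (a *: g + g') f = a *: fgmod_comp g f + fgmod_comp g' f.
Proof. exact: fgmod_homP. Qed.
Lemma fgmod_comp_linr M N P (a : k) (g : fgmod_hom N P)
  (f f' : fgmod_hom M N) :
  fgmod_comp g (a *: f + f') = a *: fgmod_comp g f + fgmod_comp g f'.
Proof. by apply: fgmod_homP => x; apply: linearP. Qed.

Definition fgmod_cat : lincat k :=
  @LinCat k (fgmod A) (fun M N => fgmod_hom M N) fgmod_id fgmod_comp
    fgmod_comp1m fgmod_compm1 fgmod_compA fgmod_comp_linl fgmod_comp_linr.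

End FgModHom.

(* falgType k requires 1 != 0, which excludes only the zero algebra, whose
   module category is the zero category. *)
Definition finite_cat (k : fieldType) (C : lincat k) :=
  exists A : falgType k, lin_equivalent C (fgmod_cat A).

Reserved Notation "X ⊗ Y" (at level 40, left associativity).

Record moncat (k : fieldType) := MonCat {
  moncat_lincat :> lincat k;
  unit_ob : moncat_lincat;
  tens : moncat_lincat -> moncat_lincat -> moncat_lincat
    where "X ⊗ Y" := (tens X Y);
  tensm : forall X X' Y Y', hom X X' -> hom Y Y' -> hom (X ⊗ Y) (X' ⊗ Y');
  tensm1 : forall X Y, tensm (idm X) (idm Y) = idm (X ⊗ Y);
  tensmM : forall X X' X'' Y Y' Y''
    (f' : hom X' X'') (f : hom X X') (g' : hom Y' Y'') (g : hom Y Y'),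
    tensm (f' \o f) (g' \o g) = tensm f' g' \o tensm f g;
  assoc : forall X Y Z, iso ((X ⊗ Y) ⊗ Z) (X ⊗ (Y ⊗ Z));
  assoc_natural : forall X X' Y Y' Z Z'
    (f : hom X X') (g : hom Y Y') (h : hom Z Z'),
    assoc X' Y' Z' \o tensm (tensm f g) h =
    tensm f (tensm g h) \o assoc X Y Z;
  lunit : forall X, iso (unit_ob ⊗ X) X;
  lunit_natural : forall X Y (f : hom X Y),
    lunit Y \o tensm (idm unit_ob) f = f \o lunit X;
  runit : forall X, iso (X ⊗ unit_ob) X;
  runit_natural : forall X Y (f : hom X Y),
    runit Y \o tensm f (idm unit_ob) = f \o runit X;
  pentagon : forall W X Y Z,
    tensm (idm W) (assoc X Y Z) \o assoc W (X ⊗ Y) Z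
      \o tensm (assoc W X Y) (idm Z) =
    assoc W X (Y ⊗ Z) \o assoc (W ⊗ X) Y Z;
  triangle : forall X Y,
    tensm (idm X) (lunit Y) \o assoc X unit_ob Y = tensm (runit X) (idm Y)
}.

Arguments unit_ob {k} C : rename.
Arguments tens {k m} X Y.
Arguments tensm {k m X X' Y Y'} f g.
Arguments assoc {k m} X Y Z.
Arguments lunit {k m} X.
Arguments runit {k m} X.

Notation "X ⊗ Y" := (tens X Y) : cat_scope.

(* ev and coev exhibit D as a left dual of X, equivalently X as a right dual
   of D. *)
Definition is_duality (k : fieldType) (C : moncat k) (D X : C)
    (ev : hom (D ⊗ X) (unit_ob C)) (coev : hom (unit_ob C) (X ⊗ D)) :=
  runit X \o tensm (idm X) ev \o assoc X D X \o tensm coev (idm X)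
    \o isoV (lunit X) = idm X /\
  lunit D \o tensm ev (idm D) \o isoV (assoc D X D) \o tensm (idm D) coev
    \o isoV (runit D) = idm D.

Definition rigid (k : fieldType) (C : moncat k) :=
  forall X : C,
    (exists (D : C) ev coev, @is_duality k C D X ev coev) /\
    (exists (D : C) ev coev, @is_duality k C X D ev coev).

Record tensor_cat (k : fieldType) := TensorCat {
  tensor_moncat :> moncat k;
  tensor_abelian : abelian_cat tensor_moncat;
  tensor_rigid : rigid tensor_moncat;
  tensor_unit_simple : simple_ob (unit_ob tensor_moncat);
  tensm_linl : forall (X X' Y Y' : tensor_moncat) (a : k)
    (f f' : hom X X') (g : hom Y Y'),
    tensm (a *: f + f') g = a *: tensm f g + tensm f' g;
  tensm_linr : forall (X X' Y Y' : tensor_moncat) (a : k)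
    (f : hom X X') (g g' : hom Y Y'),
    tensm f (a *: g + g') = a *: tensm f g + tensm f g';
  tensor_finite_length : forall X : tensor_moncat, finite_length X;
  tensor_hom_findim : forall X Y : tensor_moncat, findim (hom X Y)
}.

Record finite_tensor_cat (k : fieldType) := FiniteTensorCat {
  finite_tensor_tensor :> tensor_cat k;
  finite_tensor_finite : finite_cat finite_tensor_tensor
}.

Record tensor_functor (k : fieldType) (C D : tensor_cat k) := TensorFunctor {
  tensor_functor_lin :> linfunctor C D;
  fun_tens : forall X Y : C,
    iso (tensor_functor_lin X ⊗ tensor_functor_lin Y)
        (tensor_functor_lin (X ⊗ Y));
  fun_unit : iso (unit_ob D) (tensor_functor_lin (unit_ob C));
  fun_tens_natural : forall (X X' Y Y' : C) (f : hom X X') (g : hom Y Y'),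
    fun_tens X' Y' \o tensm (fhom tensor_functor_lin f)
                            (fhom tensor_functor_lin g) =
    fhom tensor_functor_lin (tensm f g) \o fun_tens X Y;
  fun_assoc : forall X Y Z : C,
    fhom tensor_functor_lin (assoc X Y Z) \o fun_tens (X ⊗ Y) Z
      \o tensm (fun_tens X Y) (idm (tensor_functor_lin Z)) =
    fun_tens X (Y ⊗ Z) \o tensm (idm (tensor_functor_lin X)) (fun_tens Y Z)
      \o assoc (tensor_functor_lin X) (tensor_functor_lin Y)
               (tensor_functor_lin Z);
  fun_lunit : forall X : C,
    fhom tensor_functor_lin (lunit X) \o fun_tens (unit_ob C) X
      \o tensm fun_unit (idm (tensor_functor_lin X)) =
    lunit (tensor_functor_lin X);
  fun_runit : forall X : C,
    fhom tensor_functor_lin (runit X) \o fun_tens X (unit_ob C)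
      \o tensm (idm (tensor_functor_lin X)) fun_unit =
    runit (tensor_functor_lin X)
}.

Arguments fun_tens {k C D} F X Y : rename.
Arguments fun_unit {k C D} F : rename.

Definition id_tensor_functor (k : fieldType) (C : tensor_cat k) :
  tensor_functor C C.
Proof.
refine (@TensorFunctor k C C (id_functor C)
  (fun X Y => id_iso (X ⊗ Y)) (id_iso (unit_ob C)) _ _ _ _) => *.
- by rewrite /= comp1m compm1.
- by rewrite /= !tensm1 !compm1 comp1m.
- by rewrite /= tensm1 !compm1.
- by rewrite /= tensm1 !compm1.
Defined.

Record mon_aut (k : fieldType) (C D : tensor_cat k) (F : tensor_functor C D) :=
  MonAut {
  mon_aut_fun :> forall X : C, hom (F X) (F X);
  mon_aut_natural : is_natural (F := F) (G := F) mon_aut_fun;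
  mon_aut_iso : forall X : C, is_iso (mon_aut_fun X);
  mon_aut_tens : forall X Y : C,
    mon_aut_fun (X ⊗ Y) \o fun_tens F X Y =
    fun_tens F X Y \o tensm (mon_aut_fun X) (mon_aut_fun Y);
  mon_aut_unit : mon_aut_fun (unit_ob C) \o fun_unit F = fun_unit F
}.

Section MonAutGroup.
Variables (k : fieldType) (C D : tensor_cat k) (F : tensor_functor C D).
Implicit Types s t u : mon_aut F.

Lemma mon_autP s t : (forall X, s X = t X) -> s = t.
Proof.
case: s t => [s s1 s2 s3 s4] [t t1 t2 t3 t4] /= e.
have est : s = t by apply: functional_extensionality_dep.
by subst t; f_equal; apply: Prop_irrelevance.
Qed.

Definition mon_aut_one : mon_aut F.
Proof.
refine (@MonAut k C D F (fun X => idm (F X)) _ _ _ _).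
- by move=> X Y f; rewrite comp1m compm1.
- by move=> X; exists (idm (F X)); rewrite comp1m.
- by move=> X Y; rewrite tensm1 comp1m compm1.
- by rewrite comp1m.
Defined.

Definition mon_aut_mul s t : mon_aut F.
Proof.
refine (@MonAut k C D F (fun X => s X \o t X) _ _ _ _).
- move=> X Y f.
  by rewrite -compA (mon_aut_natural t f) compA (mon_aut_natural s f) compA.
- move=> X; have [s' [s's ss']] := mon_aut_iso s X.
  have [t' [t't tt']] := mon_aut_iso t X.
  exists (t' \o s'); split.
    by rewrite compA -(compA t') s's compm1.
  by rewrite compA -(compA (s X)) tt' compm1.
- by move=> X Y; rewrite -compA mon_aut_tens compA mon_aut_tens tensmM compA.
- by rewrite -compA !mon_aut_unit.
Defined.

Definition mon_aut_inv_fun t (X : C) : hom (F X) (F X) :=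
  sval (cid (mon_aut_iso t X)).

Lemma mon_aut_invm t X : mon_aut_inv_fun t X \o t X = idm (F X).
Proof. by rewrite /mon_aut_inv_fun; case: cid => ? []. Qed.

Lemma mon_aut_minv t X : t X \o mon_aut_inv_fun t X = idm (F X).
Proof. by rewrite /mon_aut_inv_fun; case: cid => ? []. Qed.

Definition mon_aut_inv t : mon_aut F.
Proof.
refine (@MonAut k C D F (mon_aut_inv_fun t) _ _ _ _).
- move=> X Y f; rewrite -[LHS]compm1 -(mon_aut_minv t X) !compA.
  rewrite -(compA _ (fhom F f)) -(mon_aut_natural t f) !compA.
  by rewrite mon_aut_invm comp1m.
- by move=> X; exists (t X); rewrite mon_aut_invm mon_aut_minv.
- move=> X Y.
  rewrite -[LHS]compm1 -tensm1 -(mon_aut_minv t X) -(mon_aut_minv t Y).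
  rewrite tensmM !compA -(compA _ (isom _)) -mon_aut_tens compA.
  by rewrite mon_aut_invm comp1m.
- by rewrite -{1}(mon_aut_unit t) compA mon_aut_invm comp1m.
Defined.

Lemma mon_aut_mulA : associative mon_aut_mul.
Proof. by move=> s t u; apply: mon_autP => X; apply: compA. Qed.
Lemma mon_aut_mul1 : left_id mon_aut_one mon_aut_mul.
Proof. by move=> t; apply: mon_autP => X; apply: comp1m. Qed.
Lemma mon_aut_mulr1 : right_id mon_aut_one mon_aut_mul.
Proof. by move=> t; apply: mon_autP => X; apply: compm1. Qed.
Lemma mon_aut_mulV : left_inverse mon_aut_one mon_aut_inv mon_aut_mul.
Proof. by move=> t; apply: mon_autP => X; apply: mon_aut_invm. Qed.
Lemma mon_aut_mulrV : right_inverse mon_aut_one mon_aut_inv mon_aut_mul.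
Proof. by move=> t; apply: mon_autP => X; apply: mon_aut_minv. Qed.

End MonAutGroup.

(* The library's finite_set does not apply to mon_aut F, which is too large for
   its universe: the objects of a lincat may be as large as those of
   fgmod_cat. *)
Definition finite_type (T : Type) :=
  exists (n : nat) (f : 'I_n -> T), bijective f.

(* Main.v *)
From HB Require Import structures.
From mathcomp Require Import all_boot all_algebra all_field all_classical.
Require Import Defs.

(** The group is finite because its elements are linearly independent in a
    finite-dimensional space.

    Let P be a generator of the finite category C, that is, every object is a
    quotient of a finite sum of copies of P.  Take distinct monoidal
    automorphisms t_1, ..., t_n of F and a linear relation
    sum_i c_i t_i = 0 between their components at P.  By naturality it holds at
    sums of copies of P, and since a right exact F preserves epimorphisms it
    holds at every object X (relation_of_generator).

    Such a relation is trivial, by the argument that Dedekind used for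
    characters (mon_aut_relation_trivial).  At X ⊗ Y the relation reads
    sum_i c_i (t_i X) ⊗ (t_i Y) = 0.  In a tensor category over an
    algebraically closed field the map from Hom(X, X') ⊗ Hom(Y, Y') to
    Hom(X ⊗ Y, X' ⊗ Y') is injective (tensm_indep), so each c_i may be
    multiplied by the value at t_i Y of a fixed coordinate function on the
    endomorphisms of F Y.  Two automorphisms that differ have different
    coordinates for some Y, and induction on n eliminates all the c_i.  Hence n is at
    most the dimension of the space of endomorphisms of F P, whatever the
    characteristic.

    The injectivity is where rigidity and the field enter.  Duality replaces
    X -> X' by a map into the unit object and Y -> Y' by a map out of it, and
    the tensor product of two such maps is their composite through the unit
    object.  As the unit is simple and, by Schur's lemma, has only scalar
    endomorphisms, independent maps out of it stay independent in such
    composites (simple_indep_comp). *)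

Set Implicit Arguments.
Unset Strict Implicit.
Unset Printing Implicit Defensive.

Import GRing.Theory.
Local Open Scope ring_scope.
Local Open Scope cat_scope.

(** * Linear algebra in finite-dimensional spaces *)

Definition linear_pack (k : fieldType) (U V : lmodType k) (f : U -> V)
    (lin_f : linear f) : {linear U -> V} :=
  HB.pack f (GRing.isLinear.Build k U V *:%R f lin_f).

Lemma linear_map_sum (k : fieldType) (U V : lmodType k) (f : U -> V) n
    (u : 'I_n -> U) : linear f -> f (\sum_i u i) = \sum_i f (u i).
Proof. move=> lf; exact: (linear_sum (linear_pack lf)). Qed.

Lemma linear_mapZ (k : fieldType) (U V : lmodType k) (f : U -> V) c u :
  linear f -> f (c *: u) = c *: f u.
Proof. move=> lf; exact: (linearZ_LR (linear_pack lf)). Qed.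

Lemma linear_map0 (k : fieldType) (U V : lmodType k) (f : U -> V) :
  linear f -> f 0 = 0.
Proof. move=> lf; exact: (linear0 (linear_pack lf)). Qed.

Lemma linear_mapB (k : fieldType) (U V : lmodType k) (f : U -> V) u v :
  linear f -> f (u - v) = f u - f v.
Proof. move=> lf; exact: (linearB (linear_pack lf)). Qed.

Lemma linear_map_comb (k : fieldType) (U V : lmodType k) (f : U -> V) n
    (c : 'I_n -> k) (u : 'I_n -> U) :
  linear f -> f (\sum_i c i *: u i) = \sum_i c i *: f (u i).
Proof.
move=> lf; rewrite linear_map_sum //; apply: eq_bigr => i _.
by rewrite linear_mapZ.
Qed.

Lemma linear_can (k : fieldType) (U V : lmodType k) (f : U -> V) (g : V -> U) :
  linear f -> cancel f g -> cancel g f -> linear g.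
Proof. by move=> lf fK gK a u v; apply: (can_inj fK); rewrite lf !gK. Qed.

Definition lin_indep (k : fieldType) (V : lmodType k) n (v : 'I_n -> V) :=
  forall c : 'I_n -> k, \sum_i c i *: v i = 0 -> forall i, c i = 0.

Lemma lin_indep_inj_image (k : fieldType) (U V : lmodType k) (f : U -> V) n
    (u : 'I_n -> U) :
  linear f -> (forall x, f x = 0 -> x = 0) -> lin_indep u ->
  lin_indep (f \o u)%FUN.
Proof.
move=> lf f0 u_indep c /= e; apply: u_indep; apply: f0.
by rewrite linear_map_comb.
Qed.

Lemma findim_basis (k : fieldType) (V : lmodType k) : findim V ->
  exists (n : nat) (e : 'I_n -> V),
    lin_indep e /\ forall v, exists c : 'I_n -> k, v = \sum_i c i *: e i.
Proof.
move=> [n [[v2r lin_v2r [r2v v2rK r2vK]]]].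
have lin_r2v := linear_can lin_v2r v2rK r2vK.
exists n, (fun i => r2v (delta_mx 0 i)); split=> [c | v].
  rewrite -(linear_map_comb _ _ lin_r2v) => /(congr1 v2r).
  rewrite r2vK (linear_map0 lin_v2r) => /rowP e i.
  have := e i; rewrite summxE mxE (bigD1 i) //= big1 => [|j /negPf ji].
    by rewrite !mxE !eqxx mulr1 addr0.
  by rewrite !mxE eq_sym ji andbF mulr0.
exists (v2r v 0); rewrite -(linear_map_comb _ _ lin_r2v).
by rewrite -row_sum_delta v2rK.
Qed.

Lemma lin_indep_leq_dim (k : fieldType) (V : lmodType k) N n (v : 'I_n -> V) :
  Vector.axiom N V -> lin_indep v -> (n <= N)%N.
Proof.
move=> [v2r lin_v2r [r2v v2rK r2vK]] v_indep.
pose A : 'M[k]_(n, N) := \matrix_i v2r (v i).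
suff rA : row_free A by rewrite -(eqP rA) rank_leq_col.
rewrite -kermx_eq0; apply/rowV0P => c /sub_kermxP cA0.
apply/rowP => i; rewrite mxE; apply: v_indep i.
apply: (can_inj v2rK).
rewrite (linear_map0 lin_v2r) (linear_map_comb _ _ lin_v2r) -[RHS]cA0.
rewrite mulmx_sum_row; apply: eq_bigr => i _.
by rewrite rowK.
Qed.

(** * Bilinearity of composition *)

Section Composition.
Variables (k : fieldType) (C : lincat k) (X Y Z : C).

Lemma linear_comp_l (f : hom X Y) : linear (fun g : hom Y Z => g \o f).
Proof. by move=> a g g'; apply: comp_linl. Qed.

Lemma linear_comp_r (g : hom Y Z) : linear (fun f : hom X Y => g \o f).
Proof. by move=> a f f'; apply: comp_linr. Qed.

Lemma comp0m (f : hom X Y) : (0 : hom Y Z) \o f = 0.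
Proof. exact: (linear_map0 (linear_comp_l f)). Qed.

Lemma compm0 (g : hom Y Z) : g \o (0 : hom X Y) = 0.
Proof. exact: (linear_map0 (linear_comp_r g)). Qed.

Lemma compDm (g g' : hom Y Z) (f : hom X Y) :
  (g + g') \o f = (g \o f) + (g' \o f).
Proof. by have := comp_linl 1 g g' f; rewrite !scale1r. Qed.

Lemma compBm (g g' : hom Y Z) (f : hom X Y) :
  (g - g') \o f = (g \o f) - (g' \o f).
Proof. exact: (linear_mapB _ _ (linear_comp_l f)). Qed.

Lemma compZm a (g : hom Y Z) (f : hom X Y) : (a *: g) \o f = a *: (g \o f).
Proof. exact: (linear_mapZ _ _ (linear_comp_l f)). Qed.

Lemma compmZ a (g : hom Y Z) (f : hom X Y) : g \o (a *: f) = a *: (g \o f).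
Proof. exact: (linear_mapZ _ _ (linear_comp_r g)). Qed.

Lemma comp_suml n (g : 'I_n -> hom Y Z) (f : hom X Y) :
  (\sum_i g i) \o f = \sum_i (g i \o f).
Proof. exact: (linear_map_sum _ (linear_comp_l f)). Qed.

Lemma comp_sumr n (g : hom Y Z) (f : 'I_n -> hom X Y) :
  g \o (\sum_i f i) = \sum_i (g \o f i).
Proof. exact: (linear_map_sum _ (linear_comp_r g)). Qed.

End Composition.

(** * Simple objects *)

Section SimpleObjects.
Variables (k : fieldType) (C : lincat k).
Hypothesis abC : abelian_cat C.

Lemma kernel_comp0 (K X Y : C) (i : hom K X) (f : hom X Y) :
  is_kernel i f -> f \o i = 0.
Proof. by case. Qed.

Lemma zero_ob_id (X : C) : idm X = 0 -> is_zero_ob X.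
Proof.
move=> e Y; split=> f; first by rewrite -[f]compm1 e compm0.
by rewrite -[f]comp1m e comp0m.
Qed.

Lemma simple_id_neq0 (S : C) : simple_ob S -> idm S <> 0.
Proof. by move=> [S0 _] /zero_ob_id. Qed.

(** The kernel of f is a subobject of S, so it is zero or all of S. *)
Lemma simple_mono (S X : C) (f : hom S X) : simple_ob S -> f <> 0 -> is_mono f.
Proof.
move=> [_ simpleS] f0; have [K [i [fi0 uniq_i]]] := has_kernels abC f.
have i_mono : is_mono i.
  move=> W u v e; have [|w [_ uw]] := uniq_i W (i \o u).
    by rewrite compA fi0 comp0m.
  by rewrite -(uw u) // -(uw v).
have [K0 | [j [_ ij]]] := simpleS K i i_mono; last first.
  by case: f0; rewrite -[f]compm1 -ij compA fi0 comp0m.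
move=> W u v e; apply/eqP; rewrite -subr_eq0; apply/eqP.
have [|w [<- _]] := uniq_i W (u - v); last by rewrite (proj2 (K0 W) w) compm0.
by rewrite (linear_mapB _ _ (linear_comp_r f)) e subrr.
Qed.

Lemma simple_epi (S X : C) (f : hom X S) : simple_ob S -> f <> 0 -> is_epi f.
Proof.
move=> simpleS f0 W u v e; apply: contrapT => uv.
have uv0 : u - v <> 0 by move/eqP; rewrite subr_eq0 => /eqP.
by apply/f0/(simple_mono simpleS uv0); rewrite compBm e subrr compm0.
Qed.

Lemma simple_endo_iso (S : C) (f : hom S S) :
  simple_ob S -> f <> 0 -> is_iso f.
Proof.
move=> simpleS f0; have fmono := simple_mono simpleS f0.
by case: simpleS => S0 /(_ S f fmono) [].
Qed.

(** In an abelian category an epimorphism is the cokernel of its kernel. *)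
Lemma epi_factor (K X Y Z : C) (i : hom K X) (f : hom X Y) (h : hom X Z) :
  is_epi f -> is_kernel i f -> h \o i = 0 -> exists c : hom Y Z, h = c \o f.
Proof.
move=> /(epi_is_cokernel abC) [W [g [fg0 cok]]] [_ ker_i] hi0.
have [g' [eg _]] := ker_i W g fg0.
have [|c [ec _]] := cok Z h; first by rewrite -eg compA hi0 comp0m.
by exists c.
Qed.

End SimpleObjects.

(** Schur's lemma: post-composition with f is an endomorphism of the nonzero
    space of endomorphisms of S; on an eigenvector g, which is invertible, f
    acts as a scalar, so f is that scalar. *)
Lemma schur (k : closedFieldType) (C : lincat k) (S : C) (f : hom S S) :
  abelian_cat C -> simple_ob S -> findim (hom S S) ->
  exists a, f = a *: idm S.
Proof.
move=> abC simpleS [n [[v2r lin_v2r [r2v v2rK r2vK]]]].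
have lin_r2v := linear_can lin_v2r v2rK r2vK.
have lin_F : linear (fun v : 'rV[k]_n => v2r (f \o r2v v)).
  by move=> a u v; rewrite lin_r2v comp_linr lin_v2r.
pose A := lin1_mx (linear_pack lin_F).
have n_gt0 : (0 < n)%N.
  rewrite lt0n; apply/eqP => n0; apply: (simple_id_neq0 simpleS).
  apply: (can_inj v2rK); apply/rowP => i.
  by have := ltn_ord i; rewrite {2}n0.
have /closed_rootP [a] : size (char_poly A) != 1.
  by rewrite size_char_poly eqSS -lt0n.
rewrite -eigenvalue_root_char => /eigenvalueP [v vA v0].
exists a; pose g := r2v v.
have fg : f \o g = a *: g.
  apply: (can_inj v2rK); rewrite (linear_mapZ _ _ lin_v2r) r2vK -vA.
  by rewrite mul_rV_lin1.
have [|h [_ gh]] := simple_endo_iso (f := g) abC simpleS.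
  move=> g0; move/eqP: v0; apply.
  by rewrite -[v]r2vK -/g g0 linear_map0.
by rewrite -[f]compm1 -gh compA fg compZm.
Qed.

(** Independent maps out of a simple object S with scalar endomorphisms embed a
    direct sum of copies of S.  Without forming that sum: if the first a is
    nonzero then it is epi; by induction the other a's vanish on its kernel,
    so they are scalar multiples of it, and the relation becomes a linear
    relation between the b's. *)
Lemma simple_indep_comp (k : fieldType) (C : lincat k) (S W Z : C) :
  abelian_cat C -> simple_ob S ->
  (forall f : hom S S, exists a, f = a *: idm S) ->
  forall n (b : 'I_n -> hom S W) (a : 'I_n -> hom Z S),
    lin_indep b -> \sum_i (b i \o a i) = 0 -> forall i, a i = 0.
Proof.
move=> abC simpleS scalS n; elim: n Z => [|n IHn] Z b a b_indep.
  by move=> _ [].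
rewrite big_ord_recl => ba0.
have b'_indep : lin_indep (fun j => b (lift ord0 j)).
  move=> c bc0 j; pose c' i := if unlift ord0 i is Some j then c j else 0.
  suff : c' (lift ord0 j) = 0 by rewrite /c' liftK.
  apply: b_indep.
  rewrite big_ord_recl {1}/c' unlift_none scale0r add0r -[RHS]bc0.
  by apply: eq_bigr => l _; rewrite /c' liftK.
have [a0 | /eqP a0] := eqVneq (a ord0) 0.
  rewrite a0 compm0 add0r in ba0 => i.
  have [j ->|->//] := unliftP ord0 i.
  exact: (IHn Z _ (fun j => a (lift ord0 j)) b'_indep ba0 j).
have a0_epi := simple_epi abC simpleS a0.
have [K [u ker_u]] := has_kernels abC (a ord0).
have au0 j : a (lift ord0 j) \o u = 0.
  apply: (IHn K _ (fun j => a (lift ord0 j) \o u) b'_indep _ j).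
  have := congr1 (fun h => h \o u) ba0.
  rewrite comp0m compDm -compA (kernel_comp0 ker_u) compm0 add0r comp_suml => e.
  rewrite -[RHS]e.
  by apply: eq_bigr => l _; rewrite compA.
have /choice [c ac] : forall j, exists c, a (lift ord0 j) = c *: a ord0.
  move=> j; have [d ->] := epi_factor abC a0_epi ker_u (au0 j).
  by have [c ->] := scalS d; exists c; rewrite compZm comp1m.
pose c' i := if unlift ord0 i is Some j then c j else 1.
suff : c' ord0 = 0 by rewrite /c' unlift_none => /eqP; rewrite oner_eq0.
apply: b_indep; apply: a0_epi; rewrite comp0m -[RHS]ba0 comp_suml big_ord_recl.
rewrite {1}/c' unlift_none scale1r; congr (_ + _); apply: eq_bigr => j _.
by rewrite /c' liftK compZm ac compmZ.
Qed.

(** * Independence of tensor products of morphisms *)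

Section TensorSums.
Variables (k : fieldType) (C : tensor_cat k).
Implicit Types X Y Z : C.

Lemma linear_tensm_l X X' Y Y' (g : hom Y Y') :
  linear (fun f : hom X X' => tensm f g).
Proof. by move=> a f f'; apply: tensm_linl. Qed.

Lemma linear_tensm_r X X' Y Y' (f : hom X X') :
  linear (fun g : hom Y Y' => tensm f g).
Proof. by move=> a g g'; apply: tensm_linr. Qed.

Lemma tens0m X X' Y Y' (g : hom Y Y') : tensm (0 : hom X X') g = 0.
Proof. exact: (linear_map0 (linear_tensm_l _)). Qed.

Lemma tensm0 X X' Y Y' (f : hom X X') : tensm f (0 : hom Y Y') = 0.
Proof. exact: (linear_map0 (linear_tensm_r _)). Qed.

Lemma tensm_suml X X' Y Y' n (f : 'I_n -> hom X X') (g : hom Y Y') :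
  tensm (\sum_i f i) g = \sum_i tensm (f i) g.
Proof. exact: (linear_map_sum _ (linear_tensm_l _)). Qed.

Lemma tensm_sumr X X' Y Y' n (f : hom X X') (g : 'I_n -> hom Y Y') :
  tensm f (\sum_i g i) = \sum_i tensm f (g i).
Proof. exact: (linear_map_sum _ (linear_tensm_r _)). Qed.

Lemma tensmZl X X' Y Y' a (f : hom X X') (g : hom Y Y') :
  tensm (a *: f) g = a *: tensm f g.
Proof. exact: (linear_mapZ _ _ (linear_tensm_l _)). Qed.

Lemma tensmZr X X' Y Y' a (f : hom X X') (g : hom Y Y') :
  tensm f (a *: g) = a *: tensm f g.
Proof. exact: (linear_mapZ _ _ (linear_tensm_r _)). Qed.

Lemma tensm_interchange X X' Y Y' (f : hom X X') (g : hom Y Y') :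
  tensm (idm X') g \o tensm f (idm Y) = tensm f (idm Y') \o tensm (idm X) g.
Proof. by rewrite -!tensmM !comp1m !compm1. Qed.

Lemma lunitV_natural X Y (f : hom X Y) :
  isoV (lunit Y) \o f = tensm (idm (unit_ob C)) f \o isoV (lunit X).
Proof.
rewrite -[f in LHS]compm1 -(isomV (lunit X)) !compA -(compA _ f) -lunit_natural.
by rewrite compA isoVm comp1m.
Qed.

Lemma tensm_through_unit Z W (a : hom Z (unit_ob C)) (b : hom (unit_ob C) W) :
  lunit W \o tensm a b \o isoV (runit Z) =
  b \o (lunit (unit_ob C) \o isoV (runit (unit_ob C)) \o a).
Proof.
have -> : tensm a b = tensm (idm _) b \o tensm a (idm _).
  by rewrite -tensmM comp1m compm1.
rewrite compA lunit_natural -!compA; congr (_ \o (_ \o _)).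
rewrite -[RHS]compm1 -(isomV (runit Z)) compA -(compA _ a) -runit_natural.
by rewrite compA isoVm comp1m.
Qed.

Lemma sum_tensm_assoc_l X X' Y Y' Z Z' (h : hom Z Z') n
    (f : 'I_n -> hom X X') (g : 'I_n -> hom Y Y') :
  \sum_i tensm (f i) (g i) = 0 -> \sum_i tensm (f i) (tensm (g i) h) = 0.
Proof.
move=> fg0.
transitivity (assoc X' Y' Z' \o tensm (\sum_i tensm (f i) (g i)) h
                \o isoV (assoc X Y Z)).
  rewrite tensm_suml comp_sumr comp_suml; apply: eq_bigr => i _.
  by rewrite assoc_natural -compA isomV compm1.
by rewrite fg0 tens0m compm0 comp0m.
Qed.

Lemma sum_tensm_assoc_r X X' Y Y' Z Z' (h : hom Z Z') n
    (f : 'I_n -> hom X X') (g : 'I_n -> hom Y Y') :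
  \sum_i tensm (f i) (g i) = 0 -> \sum_i tensm (tensm h (f i)) (g i) = 0.
Proof.
move=> fg0.
transitivity (isoV (assoc Z' X' Y') \o tensm h (\sum_i tensm (f i) (g i))
                \o assoc Z X Y).
  rewrite tensm_sumr comp_sumr comp_suml; apply: eq_bigr => i _.
  by rewrite -compA -assoc_natural compA isoVm comp1m.
by rewrite fg0 tensm0 compm0 comp0m.
Qed.

End TensorSums.

Section Duality.
Variables (k : fieldType) (C : tensor_cat k) (X D : C).
Variables (ev : hom (D ⊗ X) (unit_ob C)) (coev : hom (unit_ob C) (X ⊗ D)).
Hypothesis dual : is_duality ev coev.

(** Half of the adjunction Hom(X, Y) = Hom(1, Y ⊗ D); the zigzag identity
    recovers g from its image. *)
Lemma mate_eq0 Y (g : hom X Y) : tensm g (idm D) \o coev = 0 -> g = 0.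
Proof.
move=> g0; have [zig _] := dual.
transitivity (runit Y \o tensm (idm Y) ev \o assoc Y D X
                \o tensm (tensm g (idm D) \o coev) (idm X) \o isoV (lunit X)).
  rewrite -[g in LHS]compm1 -{1}zig !compA; congr (_ \o _).
  rewrite -(runit_natural g) -(compA (runit Y)) -tensm_interchange -tensm1.
  rewrite -!compA; congr (_ \o (_ \o _)).
  by rewrite compA -assoc_natural -compA -tensmM comp1m.
by rewrite g0 tens0m compm0 comp0m.
Qed.

(** Half of the adjunction Hom(Y, X) = Hom(D ⊗ Y, 1), by the same zigzag
    identity. *)
Lemma comate_eq0 Y (f : hom Y X) : ev \o tensm (idm D) f = 0 -> f = 0.
Proof.
move=> f0; have [zig _] := dual.
transitivity (runit X \o tensm (idm X) (ev \o tensm (idm D) f) \o assoc X D Y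
                \o tensm coev (idm Y) \o isoV (lunit Y)).
  rewrite -[f in LHS]comp1m -{1}zig -!compA lunitV_natural; congr (_ \o _).
  rewrite !compA; congr (_ \o _).
  rewrite -(compA _ (tensm coev _)) -tensm_interchange -tensm1 compA.
  rewrite -(compA _ (assoc _ _ _)) assoc_natural compA; congr (_ \o _ \o _).
  by rewrite -tensmM comp1m.
by rewrite f0 tensm0 compm0 !comp0m.
Qed.

End Duality.

(** Duality turns the f's into maps a to the unit object and the g's into maps
    b out of it, and tensm a b is, up to unitors, the composite of a and b
    through the unit object, which is simple with scalar endomorphisms.  This
    is the injectivity of Hom(X, X') ⊗ Hom(Y, Y') -> Hom(X ⊗ Y, X' ⊗ Y'). *)
Lemma tensm_indep (k : closedFieldType) (C : tensor_cat k) (X X' Y Y' : C) n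
    (f : 'I_n -> hom X X') (g : 'I_n -> hom Y Y') :
  lin_indep g -> \sum_i tensm (f i) (g i) = 0 -> forall i, f i = 0.
Proof.
move=> g_indep fg0 i.
have [D' [ev' [coev' dual']]] := proj1 (tensor_rigid X').
have [D [ev [coev dual]]] := proj1 (tensor_rigid Y).
pose a j := ev' \o tensm (idm D') (f j).
pose b j := tensm (g j) (idm D) \o coev.
(* An automorphism of the unit object, so that u \o a j = 0 gives a j = 0. *)
pose u := lunit (unit_ob C) \o isoV (runit (unit_ob C)).
have b_indep : lin_indep b.
  apply: (lin_indep_inj_image (f := fun g => tensm g (idm D) \o coev)) g_indep.
    by move=> c g1 g2; rewrite tensm_linl comp_linl.
  exact: (mate_eq0 dual).
have ab0 : \sum_j tensm (a j) (b j) = 0.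
  have := sum_tensm_assoc_l (idm D) (sum_tensm_assoc_r (idm D') fg0).
  move/(congr1 (fun h => tensm ev' (idm _) \o h \o tensm (idm _) coev)).
  rewrite compm0 comp0m comp_sumr comp_suml => e; rewrite -[RHS]e.
  by apply: eq_bigr => j _; rewrite -!tensmM compm1 comp1m.
have ba0 : \sum_j (b j \o (u \o a j)) = 0.
  transitivity (lunit _ \o (\sum_j tensm (a j) (b j)) \o isoV (runit _)).
    rewrite comp_sumr comp_suml; apply: eq_bigr => j _.
    by rewrite tensm_through_unit.
  by rewrite ab0 compm0 comp0m.
have scal1 := fun h => schur h (tensor_abelian C) (tensor_unit_simple C)
  (tensor_hom_findim _ _).
have := simple_indep_comp (tensor_abelian C) (tensor_unit_simple C) scal1
  b_indep ba0 i.
move/(congr1 (fun h => runit _ \o isoV (lunit _) \o h)).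
rewrite compm0 /u !compA -(compA _ (isoV (lunit _))) isoVm compm1 isomV comp1m.
exact: (comate_eq0 dual').
Qed.

(** * A generator of a finite category *)

(** The identity says that Q is a direct summand of a finite sum of copies of P.
    This form avoids that sum itself: linear functors preserve the identity,
    and through it a natural endomorphism is determined at Q by its component
    at P. *)
Definition generator (k : fieldType) (C : lincat k) (P : C) :=
  forall X : C, exists (n : nat) (Q : C) (i : 'I_n -> hom P Q)
    (q : 'I_n -> hom Q P) (p : hom Q X),
    \sum_j (i j \o q j) = idm Q /\ is_epi p.

Section FreeModules.
Variables (k : fieldType) (A : falgType k).

Lemma fin_gen_row n : @fin_gen A 'rV[A]_n.
Proof.
exists n, (fun j => delta_mx 0 j) => x; exists (x 0); exact: row_sum_delta.
Qed.

Definition free_mod n : fgmod A := FgMod (fin_gen_row n).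

Definition free_mod_hom m n (B : 'M[A]_(m, n)) :
  fgmod_hom (free_mod m) (free_mod n) := mulmxr B.

Definition lift_gens_fun (M : fgmod A) n (g : 'I_n -> M) (v : 'rV[A]_n) : M :=
  \sum_j v 0 j *: g j.

Lemma lift_gens_linear (M : fgmod A) n (g : 'I_n -> M) :
  linear (lift_gens_fun g).
Proof.
move=> a u v; rewrite /lift_gens_fun scaler_sumr -big_split.
by apply: eq_bigr => j _; rewrite !mxE scalerDl scalerA.
Qed.

Definition lift_gens (M : fgmod A) n (g : 'I_n -> M) :
  fgmod_hom (free_mod n) M :=
  HB.pack (lift_gens_fun g)
    (GRing.isLinear.Build A 'rV[A]_n M *:%R _ (lift_gens_linear g)).

Lemma fgmod_generator : @generator k (fgmod_cat A) (free_mod 1).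
Proof.
move=> M; have [n [g gP]] := fgmodP M.
exists n, (free_mod n), (fun j => free_mod_hom (delta_mx 0 j)),
  (fun j => free_mod_hom (delta_mx j 0)), (lift_gens g); split.
  apply: fgmod_homP => x.
  have ev_sum (h : 'I_n -> fgmod_hom (free_mod n) (free_mod n)) :
      (\sum_j h j : fgmod_hom _ _) x = \sum_j h j x.
    by elim/big_rec2: _ => // j y z _ <-.
  rewrite [LHS]ev_sum /= -[RHS]mulmx1 mx1_sum_delta mulmx_sumr.
  apply: eq_bigr => j _; rewrite /= -mulmxA mul_delta_mx_cond eqxx.
  by rewrite mulr1n.
move=> N u v uv; apply: fgmod_homP => x; have [c ->] := gP x.
have -> : \sum_j c j *: g j = lift_gens g (\row_j c j).
  by apply: eq_bigr => j _; rewrite mxE.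
exact: (congr1 (fun h : fgmod_hom (free_mod n) N => h (\row_j c j)) uv).
Qed.

End FreeModules.

Lemma fhom_sum (k : fieldType) (C D : lincat k) (F : linfunctor C D) (X Y : C) n
    (f : 'I_n -> hom X Y) : fhom F (\sum_i f i) = \sum_i fhom F (f i).
Proof. exact: (linear_map_sum _ (@fhom_linear _ _ _ F X Y)). Qed.

Lemma iso_epi (k : fieldType) (C : lincat k) (X Y : C) (f : hom X Y) :
  is_iso f -> is_epi f.
Proof.
move=> [g [_ fg]] W u v uv.
by rewrite -[u]compm1 -[v]compm1 -fg !compA uv.
Qed.

(** An equivalence preserves sums, being linear, and epimorphisms, being full
    and faithful up to isomorphism. *)
Lemma finite_cat_generator (k : fieldType) (C : lincat k) :
  finite_cat C -> exists P : C, generator P.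
Proof.
move=> [A [E [G [[s [s_nat s_iso]] [t [t_nat t_iso]]]]]].
exists (G (free_mod A 1)) => X.
have [n [Q [i [q [p [iq p_epi]]]]]] := fgmod_generator (E X).
exists n, (G Q), (fun j => fhom G (i j)), (fun j => fhom G (q j)),
  (s X \o fhom G p); split.
  rewrite -fhom1 -iq fhom_sum.
  by apply: eq_bigr => j _; rewrite fhomM.
have E_faithful V W (f g : hom V W) : fhom E f = fhom E g -> f = g.
  move=> fg; apply: (iso_epi (s_iso V)).
  by rewrite -(s_nat _ _ f) -(s_nat _ _ g) /= fg.
have EGp_epi : is_epi (fhom E (fhom G p)).
  move=> W f g fg; have [t' [t't tt']] := t_iso (E X).
  have p't : t (E X) \o fhom E (fhom G p) = p \o t Q := t_nat _ _ p.
  suff : f \o t' = g \o t'.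
    by move/(congr1 (fun h => h \o t (E X))); rewrite -!compA t't !compm1.
  apply: p_epi; apply: (iso_epi (t_iso Q)).
  by rewrite -!compA -p't !(compA t') t't !comp1m fg.
move=> W f g; rewrite !compA => fg; apply: (iso_epi (s_iso X)).
by apply: E_faithful; apply: EGp_epi; rewrite -!fhomM fg.
Qed.

(** * Relations between monoidal automorphisms *)

Section Relations.
Variables (k : fieldType) (C D : tensor_cat k) (F : tensor_functor C D).

Definition relation n (t : 'I_n -> mon_aut F) (c : 'I_n -> k) :=
  forall X : C, \sum_i c i *: t i X = 0.

Lemma right_exact_epi (X Y : C) (p : hom X Y) :
  right_exact F -> is_epi p -> is_epi (fhom F p).
Proof.
move=> exF /(epi_is_cokernel (tensor_abelian C)) [Z [g /exF [Fpg0 cok]]].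
move=> W u v uv; have [|w [_ uniq_w]] := cok W (u \o fhom F p).
  by rewrite -compA Fpg0 compm0.
by rewrite -(uniq_w u) // -(uniq_w v).
Qed.

(** By naturality the relation passes from P to summands of sums of copies of
    P, and from there to their quotients because F preserves epimorphisms. *)
Lemma relation_of_generator (P : C) n (t : 'I_n -> mon_aut F) c :
  right_exact F -> generator P -> \sum_i c i *: t i P = 0 -> relation t c.
Proof.
move=> exF genP tP0 X; have [m [Q [i [q [p [iq p_epi]]]]]] := genP X.
have tQ0 : \sum_l c l *: t l Q = 0.
  rewrite -[LHS]compm1 -fhom1 -iq fhom_sum comp_sumr big1 // => j _.
  transitivity (fhom F (i j) \o (\sum_l c l *: t l P) \o fhom F (q j)).
    rewrite fhomM compA; congr (_ \o _); rewrite comp_suml comp_sumr.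
    apply: eq_bigr => l _.
    by rewrite compZm compmZ (mon_aut_natural (t l)).
  by rewrite tP0 compm0 comp0m.
apply: (right_exact_epi exF p_epi); rewrite comp0m.
transitivity (fhom F p \o (\sum_l c l *: t l Q)); last by rewrite tQ0 compm0.
rewrite comp_suml comp_sumr; apply: eq_bigr => l _.
by rewrite compZm compmZ (mon_aut_natural (t l)).
Qed.

(** This is the relation at the object X ⊗ Y, transported along the tensor
    structure of F. *)
Lemma relation_tensm n (t : 'I_n -> mon_aut F) c (X Y : C) :
  relation t c -> \sum_i tensm (c i *: t i X) (t i Y) = 0.
Proof.
move=> /(_ (X ⊗ Y)) t0.
transitivity (isoV (fun_tens F X Y) \o (\sum_i c i *: t i (X ⊗ Y))
                \o fun_tens F X Y); last by rewrite t0 compm0 comp0m.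
rewrite comp_sumr comp_suml; apply: eq_bigr => i _.
by rewrite compmZ compZm -compA mon_aut_tens compA isoVm comp1m tensmZl.
Qed.

Lemma mon_aut_unit_neq0 (t : mon_aut F) : t (unit_ob C) <> 0.
Proof.
move=> t0; apply: (simple_id_neq0 (tensor_unit_simple D)).
by rewrite -(isoVm (fun_unit F)) -(mon_aut_unit t) t0 comp0m compm0.
Qed.

End Relations.

Lemma mon_aut_neq (k : fieldType) (C D : tensor_cat k) (F : tensor_functor C D)
    (s t : mon_aut F) : s <> t -> exists X, s X <> t X.
Proof.
move=> st; apply: contrapT => noX; apply: st; apply: mon_autP => X.
by apply: contrapT => stX; apply: noX; exists X.
Qed.

(** Dedekind's argument for the independence of characters.  Multiplying each
    c i by a fixed coordinate of t i Y gives another relation, by independence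
    of tensor products.  Subtracting a multiple of the first relation from it
    removes the term at index 0; by induction the other coefficients
    c i * (b i l - b 0 l) vanish, and some b i l differs from b 0 l because t i
    and t 0 differ at some Y. *)
Lemma mon_aut_relation_trivial (k : closedFieldType) (C D : tensor_cat k)
    (F : tensor_functor C D) n (t : 'I_n -> mon_aut F) c :
  injective t -> relation t c -> forall i, c i = 0.
Proof.
elim: n t c => [|n IHn] t c t_inj rel_c; first by case.
have c_lift0 j : c (lift ord0 j) = 0.
  have [|Y tY] := @mon_aut_neq _ _ _ F (t (lift ord0 j)) (t ord0).
    by move/t_inj/eqP; rewrite eq_sym (negPf (neq_lift _ _)).
  have [m [e [e_indep /choice [coord coordK]]]] :=
    findim_basis (tensor_hom_findim (F Y) (F Y)).
  pose b i l := coord (t i Y) l.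
  (* The relation at X ⊗ Y, read in the basis e of the second factor. *)
  have rel_cb l : relation t (fun i => c i * b i l).
    move=> X; pose f l' := \sum_i (c i * b i l') *: t i X.
    apply: (tensm_indep (f := f) e_indep) l.
    rewrite -[RHS](relation_tensm X Y rel_c) /f.
    under eq_bigr => l' _ do rewrite tensm_suml.
    rewrite exchange_big; apply: eq_bigr => i _ /=.
    rewrite (coordK (t i Y)) tensm_sumr; apply: eq_bigr => l' _.
    by rewrite tensmZr !tensmZl scalerA mulrC.
  have c'0 l : c (lift ord0 j) * (b (lift ord0 j) l - b ord0 l) = 0.
    move: j {tY}; apply: (IHn (fun j => t (lift ord0 j))).
      by move=> j1 j2 /t_inj /lift_inj.
    move=> X; have := rel_cb l X; rewrite big_ord_recl.
    have := rel_c X; rewrite big_ord_recl => /(congr1 (fun h => b ord0 l *: h)).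
    rewrite scaler0 scalerDr scalerA mulrC => e0 e1.
    rewrite -[RHS](subrr 0) -[X in _ = X - _]e1 -[X in _ = _ - X]e0.
    rewrite opprD addrACA subrr add0r scaler_sumr -sumrB.
    apply: eq_bigr => i _.
    by rewrite scalerA -scalerBl mulrBr [b ord0 l * _]mulrC.
  apply: contrapT => /eqP cj; apply: tY.
  rewrite (coordK (t _ Y)) [RHS](coordK (t _ Y)).
  apply: eq_bigr => l _; congr (_ *: _); apply/eqP; rewrite -subr_eq0.
  by have /eqP := c'0 l; rewrite mulf_eq0 (negPf cj).
move=> i; have [j ->|->] := unliftP ord0 i; first exact: c_lift0.
have := rel_c (unit_ob C); rewrite big_ord_recl big1 => [|j _]; last first.
  by rewrite c_lift0 scale0r.
rewrite addr0 => /eqP; rewrite scaler_eq0 => /orP [/eqP // | /eqP t0].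
by case: (@mon_aut_unit_neq0 _ _ _ _ _ t0).
Qed.

(** * Finiteness *)

Lemma finite_type_bounded (T : Type) N :
  (forall n (f : 'I_n -> T), injective f -> (n <= N)%N) -> finite_type T.
Proof.
move=> bound.
pose P n := `[< exists f : 'I_n -> T, injective f >].
have exP : exists n, P n.
  have f0 : 'I_0 -> T by case.
  by exists 0; apply/asboolP; exists f0; case.
have ubP n : P n -> (n <= N)%N by move=> /asboolP [f]; apply: bound.
case: (ex_maxnP exP ubP) => n /asboolP [f f_inj] max_n.
have f_surj y : exists i, f i = y.
  apply: contrapT => noi.
  suff /max_n : P n.+1 by rewrite ltnn.
  apply/asboolP; exists (fun i => if unlift ord0 i is Some j then f j else y).
  move=> i1 i2; case: unliftP => [j1|] ->; case: unliftP => [j2|] -> // e.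
  - by rewrite (f_inj _ _ e).
  - by case: noi; exists j1.
  - by case: noi; exists j2.
have [g gK] := choice f_surj.
by exists n, f, g => // i; apply: f_inj.
Qed.

Lemma mon_aut_finite (k : closedFieldType) (C D : tensor_cat k)
    (F : tensor_functor C D) :
  finite_cat C -> right_exact F -> finite_type (mon_aut F).
Proof.
move=> /finite_cat_generator [P genP] exF.
have [N [dimN]] := tensor_hom_findim (F P) (F P).
apply: (@finite_type_bounded _ N) => n t t_inj.
apply: (lin_indep_leq_dim (v := fun i => t i P) dimN) => c tP0.
exact: (mon_aut_relation_trivial t_inj (relation_of_generator exF genP tP0)).
Qed.

Theorem corollary1p3 (k : closedFieldType) (C : finite_tensor_cat k) :
  (forall F : tensor_functor C C, right_exact F -> finite_type (mon_aut F)) /\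
  finite_type (mon_aut (id_tensor_functor C)).
Proof.
have finC := finite_tensor_finite C.
split=> [F exF|]; first exact: mon_aut_finite.
by apply: mon_aut_finite => // X Y Q f p.
Qed.
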